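(* Let $A$ and $B$ be complex unital Banach algebras, and let $\varphi, \psi: A \to B$ be two surjective mappings (not assumed linear or continuous), where $A$ is semisimple and $\operatorname{soc}(A)$ is essential. Suppose that $$\lambda x+y \in G(A) \iff \lambda \varphi(x) + \psi(y) \in G(B) \quad \text{for all } x, y \in A \text{ and } \lambda \in \mathbb{C}.$$ Then there exist some $u \in G(B)$ and a Jordan isomorphism $J: A \to B$ such that $$\varphi(x) = \psi(x) = uJ(x) \quad \text{for all } x \in A.$$
   Context: For a complex unital Banach algebra $A$: $G(A)$ is the group of invertible elements; $A$ is semisimple if its Jacobson radical $\operatorname{rad}(A)$ is $\{0\}$. If $A$ is semisimple, its socle $\operatorname{soc}(A)$ is the smallest two-sided ideal containing all minimal left and right ideals of $A$. For semisimple $A$, $\operatorname{soc}(A)$ is essential if and only if its left annihilator is trivial, i.e. for $x\in A$, $x\operatorname{soc}(A)=\{0\}$ implies $x=0$. A Jordan isomorphism $J: A\to B$ is a linear bijective map satisfying $J(x^2)=J(x)^2$ for all $x\in A$. *)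

(* Defs.v *)
From HB Require Import structures.
From mathcomp Require Import all_boot all_order all_algebra.
From mathcomp Require Import all_classical all_reals all_analysis.
From mathcomp Require Export complex.

Set Implicit Arguments.
Unset Strict Implicit.
Unset Printing Implicit Defensive.

Import Order.TTheory GRing.Theory Num.Theory.

Local Open Scope classical_set_scope.
Local Open Scope ring_scope.

(* The norm, topology and completeness are those of the library; the product is
   part of this mixin rather than inherited from algType because MathComp's
   numDomainType already sits below rings and normed modules, so no structure
   joining the two can be declared. The ring, algebra and unit ring structures
   are then installed on the carrier below. `|1| = 1 is not required. *)
HB.mixin Record isUnitalBanachAlgebra (K : numFieldType) A
    & CompleteNormedModule K A := {
  bmul : A -> A -> A;
  bone : A;
  bmulA : associative bmul;
  bmul1l : left_id bone bmul;
  bmul1r : right_id bone bmul;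
  bmulDl : left_distributive bmul +%R;
  bmulDr : right_distributive bmul +%R;
  bscalerAl : forall (c : K) (x y : A), c *: bmul x y = bmul (c *: x) y;
  bscalerAr : forall (c : K) (x y : A), c *: bmul x y = bmul x (c *: y);
  bone_neq0 : bone != 0;
  norm_bmul_le : forall x y : A, `|bmul x y| <= `|x| * `|y|
}.

#[short(type="unitalBanachAlgType")]
HB.structure Definition UnitalBanachAlgebra (K : numFieldType) :=
  {A of isUnitalBanachAlgebra K A & CompleteNormedModule K A}.

Section AlgebraStructure.
Context (K : numFieldType) (A : unitalBanachAlgType K).

HB.instance Definition _ := GRing.Zmodule_isNzRing.Build A
  (@bmulA K A) (@bmul1l K A) (@bmul1r K A) (@bmulDl K A) (@bmulDr K A)
  (@bone_neq0 K A).

HB.instance Definition _ := GRing.Lmodule_isLalgebra.Build K A (@bscalerAl K A).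
HB.instance Definition _ := GRing.Lalgebra_isAlgebra.Build K A (@bscalerAr K A).

(* GRing.unit is the group G(A) of elements with a two-sided inverse. *)
Let bunit : pred A := fun x => `[< exists y : A, y * x = 1 /\ x * y = 1 >].

Let binv (x : A) : A :=
  if pselect (exists y : A, y * x = 1 /\ x * y = 1) is left xU
  then projT1 (cid xU) else x.

Let bmulVr : {in bunit, left_inverse 1 binv *%R}.
Proof.
move=> x /asboolP xU; rewrite /binv; case: pselect => // xU'.
by case: (cid xU') => y [].
Qed.

Let bmulrV : {in bunit, right_inverse 1 binv *%R}.
Proof.
move=> x /asboolP xU; rewrite /binv; case: pselect => // xU'.
by case: (cid xU') => y [].
Qed.

Let bunitP (x y : A) : y * x = 1 /\ x * y = 1 -> bunit x.
Proof. by move=> xy1; apply/asboolP; exists y. Qed.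

Let binv_out : {in [predC bunit], binv =1 id}.
Proof. by move=> x /asboolPn xNU; rewrite /binv; case: pselect. Qed.

HB.instance Definition _ := GRing.NzRing_hasMulInverse.Build A
  bmulVr bmulrV bunitP binv_out.

End AlgebraStructure.

Section Ideals.
Context (K : numFieldType) (A : algType K).
Implicit Types I L : set A.

Definition linear_subspace I :=
  I 0 /\ forall (c : K) (x y : A), I x -> I y -> I (c *: x + y).

Definition left_ideal I :=
  linear_subspace I /\ forall a x : A, I x -> I (a * x).

Definition right_ideal I :=
  linear_subspace I /\ forall a x : A, I x -> I (x * a).

Definition two_sided_ideal I := left_ideal I /\ right_ideal I.

Definition maximal_left_ideal I :=
  [/\ left_ideal I, I <> [set: A] &
      forall L, left_ideal L -> I `<=` L -> L = I \/ L = [set: A]].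

Definition minimal_left_ideal I :=
  [/\ left_ideal I, I <> [set 0] &
      forall L, left_ideal L -> L `<=` I -> L = [set 0] \/ L = I].

Definition minimal_right_ideal I :=
  [/\ right_ideal I, I <> [set 0] &
      forall L, right_ideal L -> L `<=` I -> L = [set 0] \/ L = I].

Definition jacobson_radical : set A :=
  \bigcap_(I in maximal_left_ideal) I.

Definition semisimple := jacobson_radical = [set 0].

Definition contains_minimal_ideals I :=
  (forall L, minimal_left_ideal L -> L `<=` I) /\
  (forall L, minimal_right_ideal L -> L `<=` I).

Definition socle : set A :=
  \bigcap_(I in [set I | two_sided_ideal I /\ contains_minimal_ideals I]) I.

Definition essential_ideal I :=
  two_sided_ideal I /\
  forall L, two_sided_ideal L -> L <> [set 0] -> I `&` L <> [set 0].

End Ideals.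

Arguments jacobson_radical {K} A.
Arguments semisimple {K} A.
Arguments socle {K} A.

Definition jordan_isomorphism (K : numFieldType) (A B : algType K)
    (J : {linear A -> B}) :=
  bijective J /\ forall x : A, J (x ^+ 2) = J x ^+ 2.

(* Main.v *)
Require Import Defs.
From HB Require Import structures.
From mathcomp Require Import all_boot all_order all_algebra.
From mathcomp Require Import all_classical all_reals all_analysis.
From mathcomp Require Import ring lra.

(** Write [G] for the invertible elements. The proof tests everything against
    elements of rank one, the [u] with [u * x * u] a scalar multiple
    [tr u x *: u] of [u] for all [x]. For such [u] and for [g] in [G],
    [g + l *: u] is invertible if and only if [1 + l * tr u g^-1] is nonzero
    ([unit_rank_one_perturb]): invertibility determines the trace [tr u g^-1],
    which is linear in [g^-1].

    Being of rank one can be read off from invertibility: it means that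
    [g + l *: u] is singular for at most one [l], for each [g] in [G]
    ([unique_singular_point_rank_one]). Hence [phi] maps rank one elements to
    rank one elements, and comparing the singular [l] on both sides gives
    [tr (phi u) (psi g)^-1 = tr u g^-1]. In other words the map
    [g |-> (psi g^-1)^-1] satisfies [tr (phi u) (F g) = tr u g]. As the socle
    of [A] is essential, the functionals [tr u] separate points
    ([essential_socle_trace_separating]), so such a map is additive where it is
    defined and extends to a linear bijection [J] of [A] onto [B] that preserves
    invertibility in both directions ([duality_linear]). Now [J] preserves rank
    one elements too, and the same argument with [J] in the place of [phi] and
    [psi] in the place of [F] shows that [psi] itself agrees on [G] with a
    linear bijection [P].

    So [P g] and [J g^-1] are inverse to each other for all [g] in [G], with
    both [P] and [J] linear. The identity
    [a^-1 + (1 - a)^-1 = (a - a ^+ 2)^-1] turns this into the Jordan identity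
    for [(P 1)^-1 * P] ([inverse_linear_jordan]). Finally [phi x + b] and
    [P x + b] are invertible for the same [b] in [G], which forces
    [phi x = P x], and likewise for [psi] ([unit_translates_inj]).

    Two facts use the norm. Elements close to [1] are invertible, by the
    geometric series. And an idempotent [f] for which [f A f] is a division ring
    has rank one: this is the Gelfand-Mazur theorem for the algebra [f A f]
    ([no_global_resolvent]), obtained here by averaging the resolvent over
    circles. The rest is algebra over a field and is stated for algebras that
    have these two properties. The radical enters only through its description
    as the set of [d] with [G + d] contained in [G], a description that the pair
    [(phi, psi)] transports. *)

Set Implicit Arguments.
Unset Strict Implicit.
Unset Printing Implicit Defensive.

Import Order.TTheory GRing.Theory Num.Theory.
Import numFieldNormedType.Exports.

Local Open Scope classical_set_scope.
Local Open Scope ring_scope.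

(** * Real-valued norms *)

(** The field [R[i]] behind a name, so that the structures on it are always
    inferred through the same path. *)
Definition cplx (R : realType) : numClosedFieldType := R[i].

Section RealNorm.
Context (R : realType).
Local Notation K := (cplx R).

(** The norm takes its values in [R[i]], where the order is partial; its real
    part is the same number in an ordered field. *)
Definition rnorm (V : normedZmodType K) (x : V) : R := complex.Re `|x|.

Definition ofreal (a : R) : K := a%:C%C.

Lemma ler_ofreal (a b : R) : (ofreal a <= ofreal b) = (a <= b).
Proof. exact: lecR. Qed.

Lemma ltr_ofreal (a b : R) : (ofreal a < ofreal b) = (a < b).
Proof. exact: ltcR. Qed.

Lemma ofrealD a b : ofreal (a + b) = ofreal a + ofreal b.
Proof. exact: rmorphD. Qed.

Lemma ofrealM a b : ofreal (a * b) = ofreal a * ofreal b.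
Proof. exact: rmorphM. Qed.

Lemma ofreal_Re (c : K) : c \is Num.real -> c = ofreal (complex.Re c).
Proof. by move=> cR; rewrite /ofreal RRe_real. Qed.

Section NormedZmod.
Context (V : normedZmodType K).
Implicit Types x y : V.

Lemma rnormE x : `|x| = ofreal (rnorm x).
Proof. exact/ofreal_Re/normr_real. Qed.

Lemma rnorm_ge0 x : 0 <= rnorm x.
Proof. by rewrite -ler_ofreal -rnormE normr_ge0. Qed.

Lemma rnorm0 : rnorm (0 : V) = 0.
Proof. by rewrite /rnorm normr0. Qed.

Lemma rnorm_eq0 x : (rnorm x == 0) = (x == 0).
Proof.
apply/eqP/eqP => [x0|->]; last exact: rnorm0.
by apply/normr0_eq0; rewrite rnormE x0.
Qed.

Lemma rnormN x : rnorm (- x) = rnorm x.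
Proof. by rewrite /rnorm normrN. Qed.

Lemma rnormB x y : rnorm (x - y) = rnorm (y - x).
Proof. by rewrite /rnorm distrC. Qed.

Lemma rnormD x y : rnorm (x + y) <= rnorm x + rnorm y.
Proof. by rewrite -ler_ofreal ofrealD -!rnormE ler_normD. Qed.

End NormedZmod.

Lemma rnorm_real (s : R) : 0 <= s -> rnorm (ofreal s) = s.
Proof. by move=> s0; rewrite /rnorm ger0_norm // ler_ofreal. Qed.

Lemma rnormcM (a b : K) : rnorm (a * b) = rnorm a * rnorm b.
Proof. by rewrite /rnorm normrM !rnormE /= mul0r subr0. Qed.

Lemma rnormcX (a : K) n : rnorm (a ^+ n) = rnorm a ^+ n.
Proof. by elim: n => [|n IH]; rewrite ?exprS ?rnormcM ?IH // /rnorm normr1. Qed.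

Lemma rnormcV (a : K) : rnorm a^-1 = (rnorm a)^-1.
Proof.
have [->|a0] := eqVneq a 0; first by rewrite invr0 rnorm0 invr0.
have ra0 : rnorm a != 0 by rewrite rnorm_eq0.
apply: (mulfI ra0); rewrite -rnormcM !divff // rnorm_real //.
Qed.

Lemma rnorm_complex_le (c : K) : rnorm c <= `|complex.Re c| + `|complex.Im c|.
Proof.
rewrite /rnorm normc_def /= -[leRHS]ger0_norm ?addr_ge0 // -sqrtr_sqr.
rewrite ler_sqrt ?sqr_ge0 // sqrrD !real_normK ?num_real //.
by rewrite addrAC lerDl mulrn_wge0 // mulr_ge0.
Qed.

Lemma Re_le_rnorm (c : K) : `|complex.Re c| <= rnorm c.
Proof.
by rewrite /rnorm normc_def /= -sqrtr_sqr ler_sqrt ?lerDl ?addr_ge0 ?sqr_ge0.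
Qed.

Lemma Im_le_rnorm (c : K) : `|complex.Im c| <= rnorm c.
Proof.
by rewrite /rnorm normc_def /= -sqrtr_sqr ler_sqrt ?lerDr ?addr_ge0 ?sqr_ge0.
Qed.

Section Algebra.
Context (A : unitalBanachAlgType K).
Implicit Types x y : A.

(** The scaling laws, restated for the module structure that underlies the
    norm: rewriting with the general ones produces other presentations of this
    structure, which no longer match syntactically. *)
Lemma scaleAl (c : K) x y : c *: (x * y) = (c *: x) * y.
Proof. exact: scalerAl. Qed.

Lemma scaleAr (c : K) x y : c *: (x * y) = x * (c *: y).
Proof. exact: scalerAr. Qed.

Lemma scaleA (a b : K) x : a *: (b *: x) = (a * b) *: x.
Proof. exact: scalerA. Qed.

Lemma scaleDr (c : K) x y : c *: (x + y) = c *: x + c *: y.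
Proof. exact: scalerDr. Qed.

Lemma scaleI (c : K) x y : c != 0 -> c *: x = c *: y -> x = y.
Proof.
by move=> c0 /(congr1 (GRing.scale c^-1)); rewrite !scaleA mulVf // !scale1r.
Qed.

Lemma rnormZ (c : K) x : rnorm (c *: x) = rnorm c * rnorm x.
Proof. by rewrite /rnorm normrZ !rnormE /= mul0r subr0. Qed.

Lemma rnormM x y : rnorm (x * y) <= rnorm x * rnorm y.
Proof. by rewrite -ler_ofreal ofrealM -!rnormE norm_bmul_le. Qed.

Lemma rnormX x n : rnorm (x ^+ n.+1) <= rnorm x ^+ n.+1.
Proof.
elim: n => [|n IH]; first by rewrite !expr1.
rewrite exprS (exprS _ n.+1); apply: (le_trans (rnormM _ _)).
by rewrite ler_wpM2l // rnorm_ge0.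
Qed.

End Algebra.
End RealNorm.

(** * The geometric series *)

Section Neumann.
Context (R : realType) (A : unitalBanachAlgType (cplx R)).
Implicit Types (x y : A) (c : cplx R).

Lemma half_expr_small (a e : R) : 0 < e -> exists n, a * 2^-1 ^+ n < e.
Proof.
move=> e0; exists (Num.bound (a / e)).
have := @upper_nthrootP _ (a / e) _ (leqnn _).
by rewrite ltr_pdivrMr // exprVn ltr_pdivrMr ?exprn_gt0 // mulrC.
Qed.

Lemma geometric_partial_sum (T : pzRingType) (x : T) n :
  (1 - x) * \sum_(i < n) x ^+ i = 1 - x ^+ n.
Proof. by rewrite -opprB mulNr -subrX1 opprB. Qed.

Lemma rnorm_small_eq0 (D : R) x :
  0 < D -> (forall e, 0 < e -> rnorm x <= D * e) -> x = 0.
Proof.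
move=> D0 xe; apply/eqP; rewrite -rnorm_eq0 eq_le rnorm_ge0 andbT.
apply/ler_addgt0Pr => e e0; rewrite add0r.
by have := xe _ (divr_gt0 e0 D0); rewrite mulrCA divff ?gt_eqF // mulr1.
Qed.

Lemma neumann x : rnorm x <= 2^-1 -> 1 - x \is a GRing.unit.
Proof.
(* [C] bounds the powers of [x] from the exponent 0 on: [`|1|] may exceed 1. *)
move=> x2; pose s n := \sum_(i < n) x ^+ i; pose C := rnorm (1 : A) + 1.
have C1 : 1 <= C by rewrite /C lerDr rnorm_ge0.
have xn n : rnorm (x ^+ n) <= C * 2^-1 ^+ n.
  case: n => [|n]; first by rewrite !expr0 mulr1 /C lerDl.
  apply: (le_trans (rnormX _ _)).
  have: rnorm x ^+ n.+1 <= 2^-1 ^+ n.+1 by rewrite lerXn2r ?nnegrE ?rnorm_ge0.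
  move=> h; apply: (le_trans h).
  by rewrite ler_peMl // exprn_ge0.
have ds n k : rnorm (s n - s (n + k)%N) <=
    C * 2 * 2^-1 ^+ n - C * 2 * 2^-1 ^+ (n + k).
  rewrite rnormB.
  elim: k => [|k IH]; first by rewrite addn0 !subrr rnorm0.
  rewrite addnS {1}/s big_ord_recr /= -/(s _) addrAC.
  apply: (le_trans (rnormD _ _)).
  apply: (le_trans (lerD IH (xn _))).
  by rewrite exprS; lra.
have dsn n k : rnorm (s n - s (n + k)%N) <= C * 2 * 2^-1 ^+ n.
  apply: (le_trans (ds n k)); rewrite gerBl mulr_ge0 ?exprn_ge0 //; lra.
have scvg : cvg (s @ \oo).
  apply: cauchy_cvg; apply: cauchy_exP => e e0.
  have ee : e = ofreal (complex.Re e) by apply: ofreal_Re; rewrite gtr0_real.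
  have re0 : 0 < complex.Re e by rewrite ee ltr_ofreal in e0.
  have [n nP] := half_expr_small (C * 2) re0.
  exists (s n); exists n => // m /= nm; rewrite -ball_normE /=.
  rewrite ee rnormE ltr_ofreal -(subnKC nm).
  exact: (le_lt_trans (dsn _ _)).
pose l := lim (s @ \oo).
have near e : 0 < e -> exists n, forall m, (n <= m)%N -> rnorm (l - s m) < e.
  move=> e0; have e0' : 0 < ofreal e by rewrite ltr_ofreal.
  have /cvgrPdist_lt/(_ _ e0') [n _ nP] := scvg.
  by exists n => m nm; have := nP _ nm; rewrite /= rnormE ltr_ofreal.
have sl e : 0 < e -> exists n,
    rnorm (l - s n) < e /\ rnorm (x ^+ n) < e.
  move=> e0; have [n nP] := near _ e0; have [m mP] := half_expr_small C e0.
  exists (n + m)%N; split; first by rewrite nP ?leq_addr.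
  apply: (le_lt_trans (xn _)); apply: le_lt_trans mP.
  rewrite ler_pM2l; last lra.
  by rewrite ler_wiXn2l ?leq_addl //; lra.
have D0 : 0 < rnorm (1 - x) + 1 by rewrite ltr_wpDl ?rnorm_ge0.
have inv1 : (1 - x) * l = 1.
  apply/eqP; rewrite -subr_eq0; apply/eqP; apply: (rnorm_small_eq0 D0) => e e0.
  have [n [n1 n2]] := sl _ e0.
  have -> : (1 - x) * l - 1 = (1 - x) * (l - s n) - x ^+ n.
    by rewrite mulrBr geometric_partial_sum opprB addrA addrAC addrK.
  apply: (le_trans (rnormD _ _)); rewrite rnormN [leRHS]mulrDl mul1r.
  rewrite lerD ?(ltW n2) //; apply: (le_trans (rnormM _ _)).
  by rewrite ler_wpM2l ?rnorm_ge0 ?ltW.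
have inv2 : l * (1 - x) = 1.
  apply/eqP; rewrite -subr_eq0; apply/eqP; apply: (rnorm_small_eq0 D0) => e e0.
  have [n [n1 n2]] := sl _ e0.
  have sC : s n * (1 - x) = (1 - x) * s n.
    rewrite mulr_suml mulr_sumr; apply: eq_bigr => i _.
    by rewrite mulrBl mulrBr mul1r mulr1 -exprS -exprSr.
  have -> : l * (1 - x) - 1 = (l - s n) * (1 - x) - x ^+ n.
    by rewrite mulrBl sC geometric_partial_sum opprB addrA addrAC addrK.
  apply: (le_trans (rnormD _ _)); rewrite rnormN [leRHS]mulrDl mul1r.
  rewrite lerD ?(ltW n2) //; apply: (le_trans (rnormM _ _)).
  by rewrite mulrC ler_wpM2l ?rnorm_ge0 ?ltW.
by apply/unitrP; exists l.
Qed.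

Lemma unit_near1 x :
  exists d : R, 0 < d /\ forall c, rnorm c <= d -> 1 + c *: x \is a GRing.unit.
Proof.
have D0 : 0 < rnorm x + 1 by rewrite ltr_wpDl ?rnorm_ge0.
exists (2^-1 / (rnorm x + 1)); split; first by rewrite divr_gt0.
move=> c cd; rewrite -[c *: x]opprK; apply: neumann; rewrite rnormN rnormZ.
move: cd; rewrite ler_pdivlMr //; apply: le_trans.
by rewrite ler_wpM2l ?rnorm_ge0 // lerDl.
Qed.

End Neumann.

(** * The Gelfand-Mazur theorem in a corner *)

Section Resolvent.
Context (R : realType) (A : unitalBanachAlgType (cplx R)).
Implicit Types (c w z : cplx R).

(** A resolvent [r] of [x], relative to the idempotent [e], that is defined on
    the whole field; [no_global_resolvent] derives a contradiction. *)
Variables (e x : A) (r : cplx R -> A).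
Hypotheses (e_neq0 : e != 0) (xe : x * e = x).
Hypotheses (re : forall w, r w * e = r w) (er : forall w, e * r w = r w).
Hypotheses (rl : forall w, r w * (w *: e - x) = e).
Hypotheses (rr : forall w, (w *: e - x) * r w = e).

Lemma resolvent_identity w z : r w - r z = (z - w) *: (r w * r z).
Proof.
have -> : r w - r z = r w * ((z *: e - x) * r z) - r w * (w *: e - x) * r z.
  by rewrite rr re rl er.
rewrite -mulrA -mulrBr -mulrBl opprB addrA subrK -scalerBl.
by rewrite -scaleAl er scaleAr.
Qed.

(** In [r z = r w + (w - z) *: (r z * r w)] the last term is at most half of
    [r z]. *)
Lemma resolvent_locally_bounded w z :
  rnorm (z - w) * rnorm (r w) <= 2^-1 -> rnorm (r z) <= 2 * rnorm (r w).
Proof.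
move=> wz.
have h1 : rnorm (r z) <=
    rnorm (r w) + rnorm (z - w) * (rnorm (r w) * rnorm (r z)).
  have -> : r z = r w + (w - z) *: (r z * r w).
    by rewrite -resolvent_identity subrKC.
  apply: (le_trans (rnormD _ _)); rewrite lerD2l rnormZ rnormB.
  rewrite ler_wpM2l ?rnorm_ge0 // -resolvent_identity subrKC mulrC.
  exact: rnormM.
have h2 : rnorm (z - w) * (rnorm (r w) * rnorm (r z)) <= 2^-1 * rnorm (r z).
  by rewrite mulrA ler_wpM2r ?rnorm_ge0.
lra.
Qed.

(** Local boundedness is uniform on a compact square around the disc. *)
Lemma resolvent_bounded (S : R) :
  exists M : R, forall w, rnorm w <= S -> rnorm (r w) <= M.
Proof.
pose Q := `[- S, S]%classic `*` `[- S, S]%classic : set (R * R)%type.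
have cQ : compact Q by apply: compact_setX; exact: segment_compact.
have := (compact_near_coveringP Q).1 cQ R (pinfty_nbhs R)
  (fun M p => rnorm (r (p.1 +i* p.2)%C) <= M) _.
case.
  move=> [a b] _ /=; set w := (a +i* b : cplx R)%C.
  pose d := 2^-1 / (2 * (rnorm (r w) + 1)).
  have n0 := rnorm_ge0 (r w).
  have d0 : 0 < d by rewrite divr_gt0 //; lra.
  exists (ball a d `*` ball b d, [set M | 2 * rnorm (r w) <= M]) => /=.
    split; last by apply: nbhs_pinfty_ge; rewrite num_real.
    by exists (ball a d, ball b d) => //; split; exact: nbhsx_ballx.
  move=> [[a' b'] M] /= [[]]; rewrite -!ball_normE /= => a'd b'd rM.
  apply: le_trans rM; apply: resolvent_locally_bounded.
  have : rnorm ((a' +i* b')%C - w) <= 2 * d.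
    apply: (le_trans (rnorm_complex_le _)) => /=.
    by rewrite [`|a' - a|]distrC [`|b' - b|]distrC; lra.
  move/(ler_wpM2r n0)/le_trans; apply.
  have -> : 2 * d * rnorm (r w) = rnorm (r w) / (rnorm (r w) + 1) / 2.
    by rewrite /d; field; lra.
  rewrite -[leRHS]mul1r ler_wpM2r // ler_pdivrMr; lra.
move=> M [_ MP]; exists (M + 1) => w wS.
have := MP (M + 1); rewrite ltrDl ltr01 => /(_ isT (complex.Re w, complex.Im w)).
case: w wS => a b wS /=; apply.
have := Re_le_rnorm (a +i* b)%C; have := Im_le_rnorm (a +i* b)%C.
by rewrite /Q /= !in_itv /= => bw aw; split; rewrite -ler_norml; lra.
Qed.

(** The function [w *: r w] is the resolvent [(e - x / w)^-1] of [x / w],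
    extended by [0] at [w = 0]. *)
Definition scaled_resolvent w := w *: r w.
Local Notation f := scaled_resolvent.

Lemma scaled_resolvent_lipschitz (S : R) : exists2 C : R, 0 < C &
  forall w z, rnorm w <= S -> rnorm z <= S ->
    rnorm (f w - f z) <= C * rnorm (w - z).
Proof.
have [M MP] := resolvent_bounded S; exists (`|M| + `|S| * (`|M| * `|M|) + 1).
  by rewrite ltr_wpDl // addr_ge0 // !mulr_ge0.
move=> w z wS zS.
have bnd t : rnorm t <= S -> rnorm (r t) <= `|M|.
  by move=> tS; apply: (le_trans (MP _ tS)); rewrite ler_norm.
have -> : f w - f z = (w - z) *: (r w - z *: (r w * r z)).
  rewrite scalerBr scaleA [(w - z) * z]mulrC -[X in z * X]opprB mulrN.
  rewrite scaleNr opprK -scaleA -resolvent_identity scalerBr scalerBl.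
  by rewrite addrA subrK.
rewrite rnormZ mulrC ler_wpM2r ?rnorm_ge0 //.
apply: (le_trans (rnormD _ _)); rewrite rnormN rnormZ.
have h : rnorm (r w * r z) <= `|M| * `|M|.
  by apply: (le_trans (rnormM _ _)); rewrite ler_pM ?rnorm_ge0 ?bnd.
have : rnorm z * rnorm (r w * r z) <= `|S| * (`|M| * `|M|).
  by rewrite ler_pM ?rnorm_ge0 // (le_trans zS) ?ler_norm.
have := bnd _ wS; lra.
Qed.

(** [root_minus1 m] is a root of unity of order [2 ^ m.+1]. *)
Fixpoint root_minus1 m : cplx R :=
  if m is m'.+1 then sqrtC (root_minus1 m') else -1.

Lemma root_minus1X m : root_minus1 m ^+ (2 ^ m) = -1.
Proof. by elim: m => [|m IH] /=; rewrite ?expr1 // expnS exprM sqrtCK. Qed.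

Lemma rnorm_root_minus1 m : rnorm (root_minus1 m) = 1.
Proof.
elim: m => [|m IH] /=; first by rewrite rnormN /rnorm normr1.
apply/eqP; rewrite -(@eqrXn2 _ 2) ?rnorm_ge0 ?ler01 // expr1n.
by rewrite expr2 -rnormcM -expr2 sqrtCK IH.
Qed.

(** The mean of [scaled_resolvent] over the products of [w] with the roots of
    unity of order dividing [2 ^ m]. These roots are the ones of order dividing
    [2 ^ m.-1] and their products with a root of [-1]. *)
Fixpoint mean_resolvent m w : A :=
  if m is m'.+1
  then 2^-1 *: (mean_resolvent m' w + mean_resolvent m' (root_minus1 m' * w))
  else f w.
Local Notation F := mean_resolvent.

Lemma mean_resolvent0 m : F m 0 = 0.
Proof.
elim: m => [|m IH] /=; first by rewrite /f scale0r.
by rewrite mulr0 IH addr0 scaler0.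
Qed.

(** Averaging does not increase the Lipschitz constant, so that the bound is
    uniform in [m]. *)
Lemma mean_resolvent_lipschitz (S C : R) m (s t : R) (u : cplx R) :
  (forall w z, rnorm w <= S -> rnorm z <= S ->
    rnorm (f w - f z) <= C * rnorm (w - z)) ->
  0 <= s <= S -> 0 <= t <= S -> rnorm u = 1 ->
  rnorm (F m (u * ofreal s) - F m (u * ofreal t)) <= C * `|s - t|.
Proof.
move=> fC /andP[s0 sS] /andP[t0 tS]; elim: m u => [|m IH] u u1 /=.
  apply: (le_trans (fC _ _ _ _)); rewrite ?rnormcM ?u1 ?mul1r ?rnorm_real //.
  rewrite -mulrBr rnormcM u1 mul1r -rmorphB /=.
  by rewrite [rnorm _]/rnorm normc_def /= expr0n addr0 sqrtr_sqr.
have h1 := IH _ u1.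
have /IH h2 : rnorm (root_minus1 m * u) = 1.
  by rewrite rnormcM rnorm_root_minus1 u1 mulr1.
rewrite -scalerBr rnormZ !mulrA opprD addrACA.
have -> : rnorm (2^-1 : cplx R) = 2^-1.
  by rewrite rnormcV; congr (_^-1); rewrite /rnorm normr_nat.
have := rnormD (F m (u * ofreal s) - F m (u * ofreal t))
  (F m (root_minus1 m * u * ofreal s) - F m (root_minus1 m * u * ofreal t)).
lra.
Qed.

Lemma mean_resolvent_eMr m w : F m w * e = F m w.
Proof.
elim: m w => [|m IH] w /=; first by rewrite /f -scaleAl re.
by rewrite -scaleAl mulrDl !IH.
Qed.

Lemma mean_resolvent_eMl m w : e * F m w = F m w.
Proof.
elim: m w => [|m IH] w /=; first by rewrite /f -scaleAr er.
by rewrite -scaleAr mulrDr !IH.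
Qed.

Lemma expr_e n : x ^+ n.+1 * e = x ^+ n.+1.
Proof. by rewrite exprSr -mulrA xe. Qed.

(** The partial fraction expansion over roots of unity says that
    [mean_resolvent m w] is the inverse of [e - (x / w) ^+ (2 ^ m)]; here it is
    cleared of denominators. *)
Lemma mean_resolventE m w :
  x ^+ (2 ^ m) * F m w = w ^+ (2 ^ m) *: (F m w - e).
Proof.
elim: m w => [|m IH] w.
  rewrite expn0 !expr1 /= /f -scaleAr; congr (_ *: _).
  by have := rr w; rewrite mulrBl -scaleAl er => <-; rewrite opprB subrKC.
have xN : x ^+ (2 ^ m) * e = x ^+ (2 ^ m).
  by rewrite -(prednK (_ : 0 < 2 ^ m)%N) ?expn_gt0 // expr_e.
have step z : x ^+ (2 ^ m.+1) * F m z =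
    (z ^+ (2 ^ m)) ^+ 2 *: (F m z - e) - z ^+ (2 ^ m) *: x ^+ (2 ^ m).
  rewrite expnS mul2n -addnn exprD -mulrA IH -scaleAr mulrBr IH xN.
  by rewrite scalerBr scaleA.
rewrite /= -scaleAr mulrDr !step exprMn root_minus1X mulN1r sqrrN scaleNr.
rewrite opprK addrACA addNr addr0 expnS mulnC exprM -scaleDr.
rewrite scaleA mulrC -scaleA addrACA; congr (_ *: _).
rewrite scaleDr; congr (_ + _).
have -> : - e - e = 2 *: (- e) by rewrite scaler_nat mulr2n.
by rewrite scaleA mulVf ?scale1r ?pnatr_eq0.
Qed.

Lemma mean_resolvent_comm m w : GRing.comm (F m w) x.
Proof.
elim: m w => [|m IH] w; last first.
  by rewrite /= /GRing.comm -scaleAl -scaleAr mulrDl mulrDr !IH.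
rewrite /= /GRing.comm /f -scaleAl -scaleAr; congr (_ *: _).
apply: oppr_inj; apply: (addrI (w *: r w)).
have := rr w; rewrite mulrBl -scaleAl er => ->.
by have := rl w; rewrite mulrBr -scaleAr re.
Qed.

(** With [a] and [a'] the resolvents of [(x / w) ^+ (2 ^ m)] and of its square,
    this is the algebraic form of [a' = - a ^+ 2 * (e - 2 *: a)^-1]. *)
Lemma mean_resolvent_double m w : w != 0 ->
  F m.+1 w = 2 *: (F m w * F m.+1 w) - F m w ^+ 2.
Proof.
move=> w0; set a := F m w; set a' := F m.+1 w.
set W := w ^+ (2 ^ m); set X := x ^+ (2 ^ m).
have W0 : W != 0 by rewrite expf_neq0.
have Xa : X * a = W *: (a - e) by exact: mean_resolventE.
have aX : a * X = X * a by apply: commrX; exact: mean_resolvent_comm.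
have ae : a * e = a by exact: mean_resolvent_eMr.
have ea' : e * a' = a' by exact: mean_resolvent_eMl.
have XXa' : X * (X * a') = W *: (W *: (a' - e)).
  rewrite mulrA -exprD addnn -mul2n -expnS mean_resolventE scaleA.
  by rewrite -exprD addnn -mul2n -expnS.
clearbody a a'.
have aXa' : a * (X * a') = W *: (a * a' - a').
  by rewrite mulrA aX Xa -scaleAl mulrBl ea'.
have Xa' : X * a' = W *: (a - a').
  have h1 : a * (X * (X * a')) = W *: (W *: (a * a' - a)).
    by rewrite XXa' -!scaleAr mulrBr ae.
  have h2 : a * (X * (X * a')) = W *: (W *: (a * a' - a') - X * a').
    by rewrite mulrA aX -mulrA aXa' -scaleAr mulrBr mulrA Xa -scaleAl mulrBl ea'.
  move: h2; rewrite h1 => /(scaleI W0) h.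
  have -> : X * a' = W *: (a * a' - a') - W *: (a * a' - a).
    by rewrite h opprB addrC subrK.
  by rewrite -scalerBr opprB addrC addrA subrK.
move: aXa'; rewrite Xa' -scaleAr => /(scaleI W0).
rewrite mulrBr => h; transitivity (a * a' - (a * a - a * a')).
  by rewrite h opprB addrC subrK.
by rewrite opprB expr2 scaler_nat mulr2n addrA.
Qed.

(** [0] is a superattracting fixed point of [a |-> - a ^+ 2 * (e - 2 *: a)^-1]. *)
Lemma mean_resolvent_contract m w : w != 0 -> rnorm (F m w) <= 4^-1 ->
  rnorm (F m.+1 w) <= 8^-1.
Proof.
move=> w0 a4; set b := rnorm (F m.+1 w).
have h2 : rnorm (2 : cplx R) = 2 by rewrite /rnorm normr_nat.
have : b <= 2 * (rnorm (F m w) * b) + rnorm (F m w) * rnorm (F m w).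
  rewrite {1}/b (mean_resolvent_double m w0); apply: (le_trans (rnormD _ _)).
  rewrite rnormN rnormZ h2 expr2 lerD ?rnormM //.
  by rewrite ler_wpM2l ?rnormM.
have := rnorm_ge0 (F m w); have := rnorm_ge0 (F m.+1 w); rewrite -/b; nra.
Qed.

(** The means vanish at [w = 0]. If they are small at radius [s] for large [m],
    then by the uniform Lipschitz bound they are still at most [4^-1] at a
    slightly larger radius, and the contraction brings them back below [8^-1].
    Finitely many such steps lead to a radius [S] larger than the norm of [x],
    where the inverse of [e - (x / S) ^+ (2 ^ m)] cannot be small. *)
Lemma no_global_resolvent : False.
Proof.
pose S := rnorm x + 1.
have S0 : 0 < S by rewrite ltr_wpDl ?rnorm_ge0.
have [C C0 fC] := scaled_resolvent_lipschitz S.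
(* The step [S / n.+1] moves the means by at most [8^-1]. *)
have [n nP] : exists n : nat, S * C * 8 < n.+1%:R.
  exists (Num.bound (S * C * 8)); apply: lt_le_trans (archi_boundP _) _.
    by rewrite !mulr_ge0 // ltW.
  by rewrite ler_nat.
pose s (j : nat) : R := S * j%:R / n.+1%:R.
have sS j : (j <= n.+1)%N -> 0 <= s j <= S.
  move=> jn; apply/andP; split; first by rewrite divr_ge0 ?mulr_ge0 // ltW.
  by rewrite /s ler_pdivrMr ?ltr0n // ler_pM2l // ler_nat.
have small j : (j <= n.+1)%N -> exists m0, forall m, (m0 <= m)%N ->
    rnorm (F m (ofreal (s j))) <= 8^-1.
  elim: j => [|j IH] jn.
    exists 0 => m _; rewrite /s mulr0 mul0r.
    by rewrite (mean_resolvent0 m : F m (ofreal 0) = 0) rnorm0.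
  have [m0 m0P] := IH (ltnW jn); exists m0.+1 => -[//|m] m0m.
  apply: mean_resolvent_contract.
    rewrite -rnorm_eq0 rnorm_real; last by case/andP: (sS _ jn).
    by rewrite !mulf_neq0 ?invr_neq0 ?pnatr_eq0 ?gt_eqF.
  have := @mean_resolvent_lipschitz S C m (s j.+1) (s j) 1 fC (sS _ jn)
    (sS _ (ltnW jn)).
  have -> : s j.+1 - s j = S / n.+1%:R.
    by rewrite /s -mulrBl -mulrBr -natr1 addrAC subrr add0r mulr1.
  have -> : rnorm (1 : cplx R) = 1 by rewrite /rnorm normr1.
  have Sn : 0 <= S / n.+1%:R by rewrite divr_ge0 // ltW.
  rewrite !mul1r ger0_norm // => /(_ erefl) h.
  have : C * (S / n.+1%:R) <= 8^-1.
    rewrite mulrA ler_pdivrMr ?ltr0n //; lra.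
  move=> h8; rewrite -[F m _](subrK (F m (ofreal (s j)))).
  apply: (le_trans (rnormD _ _)).
  by apply: (le_trans (lerD (le_trans h h8) (m0P m m0m))); lra.
have [m0 /(_ _ (leqnn _))] := small _ (leqnn n.+1).
have -> : s n.+1 = S by rewrite /s mulfK ?pnatr_eq0.
set a := F m0 _ => a8.
have e1 : 1 <= rnorm e.
  have e0 : 0 < rnorm e by rewrite lt_neqAle eq_sym rnorm_eq0 e_neq0 rnorm_ge0.
  have ee : e * e = e by rewrite -{2}(rl 0) mulrA er rl.
  by have := rnormM e e; rewrite ee ler_pMl.
have : rnorm e <= 2 * rnorm a.
  pose N := (2 ^ m0)%N; pose W := ofreal S ^+ N.
  have rW : rnorm W = S ^+ N by rewrite rnormcX rnorm_real // ltW.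
  have W0 : W != 0 by rewrite -rnorm_eq0 rW gt_eqF ?exprn_gt0.
  have -> : e = a - W^-1 *: (x ^+ N * a).
    rewrite mean_resolventE scaleA mulVf // scale1r.
    by rewrite opprB addrC subrK.
  apply: (le_trans (rnormD _ _)); rewrite rnormN rnormZ rnormcV rW.
  have : rnorm (x ^+ N * a) <= S ^+ N * rnorm a.
    apply: (le_trans (rnormM _ _)); rewrite ler_wpM2r ?rnorm_ge0 //.
    rewrite -(prednK (_ : 0 < N)%N) ?expn_gt0 //; apply: (le_trans (rnormX _ _)).
    by rewrite lerXn2r ?nnegrE ?rnorm_ge0 ?(ltW S0) // /S lerDl.
  by rewrite -ler_pdivrMl ?exprn_gt0 //; lra.
lra.
Qed.

End Resolvent.

(** * Units and the radical *)

Section Units.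
Context (K : numFieldType).

(** What the algebraic part of the proof needs to know about the norm. *)
Definition units_near_one (A : unitAlgType K) := forall x : A,
  exists N, forall n, (N <= n)%N -> 1 + n.+1%:R^-1 *: x \is a GRing.unit.

(** Under [units_near_one] these are the elements of the radical, described by
    invertibility alone. *)
Definition unit_stable (A : unitAlgType K) (d : A) :=
  forall g : A, g \is a GRing.unit -> g + d \is a GRing.unit.

Definition unit_stable_trivial (A : unitAlgType K) :=
  forall d : A, unit_stable d -> d = 0.

Context (A : unitAlgType K).
Hypothesis near1 : units_near_one A.
Implicit Types (x y a b d g h u v : A) (c l : K).

Lemma natS_neq0 n : n.+1%:R != 0 :> K.
Proof. by rewrite pnatr_eq0. Qed.

Lemma unitZ c g : c != 0 -> (c *: g \is a GRing.unit) = (g \is a GRing.unit).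
Proof. by move=> c0; rewrite scaler_unit ?unitfE. Qed.

Lemma unit_natS_add x : exists N, forall n, (N <= n)%N ->
  n.+1%:R%:A + x \is a GRing.unit.
Proof.
have [N NP] := near1 x; exists N => n /NP.
rewrite -(unitZ _ (natS_neq0 n)) scalerDr scalerA divff ?natS_neq0 //.
by rewrite scale1r.
Qed.

Lemma sum_of_units x : exists g h,
  [/\ g \is a GRing.unit, h \is a GRing.unit & x = g + h].
Proof.
have [N /(_ _ (leqnn _)) NU] := unit_natS_add x.
exists (N.+1%:R%:A + x), (- N.+1%:R%:A); split => //.
  by rewrite unitrN unitZ ?unitr1 // natS_neq0.
by rewrite addrAC subrr add0r.
Qed.

Lemma unit_stableD d d' :
  unit_stable d -> unit_stable d' -> unit_stable (d + d').
Proof. by move=> dU d'U g gU; rewrite addrA; apply/d'U/dU. Qed.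

(** Clear when [a] is invertible, and every element is a sum of two units. *)
Lemma unit_stableMl a d : unit_stable d -> unit_stable (a * d).
Proof.
move=> dU; have gd g : g \is a GRing.unit -> unit_stable (g * d).
  move=> gU h hU; have -> : h + g * d = g * (g^-1 * h + d).
    by rewrite mulrDr mulVKr.
  by rewrite unitrMl // dU // unitrMl ?unitrV.
have [g [h [gU hU ->]]] := sum_of_units a.
by rewrite mulrDl; apply: unit_stableD; exact: gd.
Qed.

Lemma unit_stable_of_left_multiples d :
  (forall b, 1 + b * d \is a GRing.unit) -> unit_stable d.
Proof.
move=> dU g gU; have -> : g + d = g * (1 + g^-1 * d).
  by rewrite mulrDr mulr1 mulVKr.
by rewrite unitrMl.
Qed.

(** If [d] lies outside a maximal left ideal [I], then [1 = i + a * d] with [i]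
    in [I], so that [i = 1 - a * d] is a unit of [I]. *)
Lemma unit_stable_subset_radical d : unit_stable d -> jacobson_radical A d.
Proof.
move=> dU I [[[I0 ID] IM] IT Imax]; apply: contrapT => Id.
pose L := [set z | exists i a : A, I i /\ z = i + a * d].
have Lid : left_ideal L.
  split; first split.
  - by exists 0, 0; rewrite mul0r addr0.
  - move=> c _ _ [i [a [Ii ->]]] [j [b [Ij ->]]].
    exists (c *: i + j), (c *: a + b); split; first exact: ID.
    by rewrite mulrDl -scalerAl scalerDr addrACA.
  - move=> x _ [i [a [Ii ->]]]; exists (x * i), (x * a); split; first exact: IM.
    by rewrite mulrDr mulrA.
have IL : I `<=` L by move=> i Ii; exists i, 0; rewrite mul0r addr0.
have Ld : L d by exists 0, 1; rewrite mul1r add0r.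
have [LI|LT] := Imax _ Lid IL; first by apply: Id; rewrite -LI.
have [i [a [Ii i1]]] : L 1 by rewrite LT.
have iU : i \is a GRing.unit.
  have -> : i = 1 + (- a) * d by rewrite i1 mulNr addrK.
  by apply: (unit_stableMl _ dU); exact: unitr1.
apply: IT; apply/seteqP; split => // z _.
by rewrite -[z](mulrVK iU); exact: IM.
Qed.

Lemma semisimple_unit_stable_trivial : semisimple A -> unit_stable_trivial A.
Proof.
by move=> ssA d /unit_stable_subset_radical; rewrite ssA.
Qed.

Hypothesis triv : unit_stable_trivial A.

(** Each [b * x] squares to zero, hence [1 + b * x] has the inverse
    [1 - b * x]. *)
Lemma semiprime x : (forall b, x * b * x = 0) -> x = 0.
Proof.
move=> x0; apply: triv; apply: unit_stable_of_left_multiples => b.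
have bx : b * x * (b * x) = 0 by rewrite -!mulrA (mulrA x) x0 mulr0.
apply/unitrP; exists (1 - b * x); split.
  by rewrite mulrBl mul1r mulrDr mulr1 bx addr0 addrK.
by rewrite mulrDl mul1r mulrBr mulr1 bx subr0 subrK.
Qed.

End Units.

(** * Idempotents of minimal one-sided ideals *)

Section Idempotents.

(** The ring [f T f] with unit [f] is a division ring: left inverses are
    enough. *)
Definition division_corner (T : pzRingType) (f : T) :=
  forall b, f * b * f != 0 -> exists y, f * y * f * (f * b * f) = f.

(** Brauer's lemma. The hypothesis on [k] says that [T x] is a minimal left
    ideal; on it, right multiplication by [c * x] is injective, and [f] is the
    element of [T x] that it maps to [c * x]. *)
Lemma minimal_left_idempotent (T : pzRingType) (x c : T) :
  x * c * x != 0 -> (forall k, k * x != 0 -> exists z, z * (k * x) = x) ->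
  exists f, [/\ f * f = f, x * f = x, f != 0 & division_corner f].
Proof.
move=> xcx minx; have [z zE] := minx _ xcx.
have [f fE] : exists f, f = c * z * x by exists (c * z * x).
have fcx : f * (c * x) = c * x by rewrite fE -!mulrA (mulrA x) zE.
have inj k : k * x * (c * x) = 0 -> k * x = 0.
  move=> k0; apply/eqP/negPn/negP => /minx[z' z'E]; move/negP: xcx; apply.
  have -> : x * c * x = z' * (k * x * (c * x)) by rewrite !mulrA -(mulrA z' k) z'E.
  by rewrite k0 mulr0.
have ff : f * f = f.
  apply/eqP; rewrite -subr_eq0; apply/eqP.
  have -> : f * f - f = (f * c * z - c * z) * x by rewrite mulrBl fE !mulrA.
  apply: inj; have -> : (f * c * z - c * z) * x = f * f - f.
    by rewrite mulrBl fE !mulrA.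
  by rewrite mulrBl -mulrA !fcx subrr.
have xf : x * f = x.
  apply/eqP; rewrite -subr_eq0; apply/eqP.
  have -> : x * f - x = (x * c * z - 1) * x by rewrite mulrBl mul1r fE !mulrA.
  apply: inj; have -> : (x * c * z - 1) * x = x * f - x.
    by rewrite mulrBl mul1r fE !mulrA.
  by rewrite mulrBl -mulrA fcx subrr.
exists f; split => //.
  by apply: contra_neq xcx => f0; rewrite -xf f0 !(mulr0, mul0r).
move=> b fbf; have [z' z'E] : exists z', z' * (f * b * f) = x.
  have [|z' z'E] := minx (f * b * c * z); first by move: fbf; rewrite fE !mulrA.
  by exists z'; rewrite -[in RHS]z'E fE !mulrA.
exists (c * z * z').
have -> : f * (c * z * z') * f * (f * b * f) = f * (c * z * (z' * (f * b * f))).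
  by rewrite !mulrA -(mulrA _ f f) ff.
by rewrite z'E -fE ff.
Qed.

(** The mirror image, from the converse ring. It yields right inverses in
    [f T f]; as these are again nonzero, they are two-sided. *)
Lemma minimal_right_idempotent (T : nzRingType) (x c : T) :
  x * c * x != 0 -> (forall k, x * k != 0 -> exists z, x * k * z = x) ->
  exists f, [/\ f * f = f, f * x = x, f != 0 & division_corner f].
Proof.
move=> xcx minx.
have [f [ff fx f0 rinv]] : exists f : T, [/\ f * f = f, f * x = x, f != 0 &
    forall b : T, f * b * f != 0 -> exists y, f * b * f * (f * y * f) = f].
  have [||f [ff fx f0 fdiv]] := @minimal_left_idempotent T^c x c.
  - by rewrite -mulrA in xcx.
  - by move=> k /minx[z zE]; exists z.
  exists f; split => // b; rewrite -(mulrA (f : T)) => /fdiv[y yE].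
  by exists y; rewrite -(mulrA (f : T) y).
exists f; split => //.
move=> b fbf; have [y yE] := rinv _ fbf; exists y.
have [w wE] : exists w, f * y * f * (f * w * f) = f.
  by apply: rinv; apply: contra_neq f0 => y0; rewrite -yE y0 mulr0.
suff -> : f * b * f = f * w * f by [].
have := congr1 (fun t => t * (f * w * f)) yE.
rewrite -mulrA wE /=.
by rewrite -!mulrA !(mulrA f f) !ff.
Qed.

End Idempotents.

(** * Elements of rank one *)

Section RankOne.
Context (K : numFieldType).

Definition rank_one (A : algType K) (u : A) :=
  forall x, exists c : K, u * x * u = c *: u.

(** The conclusion of the Gelfand-Mazur theorem for all corners [f A f]. *)
Definition division_corners_scalar (A : algType K) := forall f : A,
  f * f = f -> f != 0 -> division_corner f -> rank_one f.

(** Rank at most one, expressed by invertibility alone. *)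
Definition unique_singular_point (A : unitAlgType K) (u : A) :=
  forall g l m, g \is a GRing.unit ->
  g + l *: u \isn't a GRing.unit -> g + m *: u \isn't a GRing.unit -> l = m.

Context (A : unitAlgType K).
Implicit Types (x y a b d g h u v : A) (c l m : K).

Lemma rank_oneMl a u : rank_one u -> rank_one (a * u).
Proof.
move=> uR x; have [c cE] := uR (x * a); exists c.
by rewrite scalerAr -cE !mulrA.
Qed.

Lemma rank_oneMr a u : rank_one u -> rank_one (u * a).
Proof.
move=> uR x; have [c cE] := uR (a * x); exists c.
by rewrite scalerAl -cE !mulrA.
Qed.

(** The trace of [u * x] when [u] has rank one. For [u = 0] the scalar is not
    determined, and [0] is the value that keeps the formulas below valid. *)
Definition tr u x : K := xget 0 [set c | u != 0 /\ u * x * u = c *: u].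

Lemma tr0 x : tr 0 x = 0.
Proof. by rewrite /tr; case: xgetP => // c _ []; rewrite eqxx. Qed.

Lemma trE u x : rank_one u -> u * x * u = tr u x *: u.
Proof.
move=> uR; have [->|u0] := eqVneq u 0; first by rewrite mulr0 scaler0.
rewrite /tr; case: xgetP => [c _ []//|none].
by have [c cE] := uR x; case: (none c).
Qed.

Lemma tr_unique u x c : u != 0 -> u * x * u = c *: u -> tr u x = c.
Proof.
move=> u0 cE; have [_ E] := @xgetPex _ 0 [set c | u != 0 /\ u * x * u = c *: u]
  (ex_intro _ c (conj u0 cE)).
apply/eqP; rewrite -subr_eq0; apply: contraNT u0 => n0; apply/eqP.
by apply: (scalerI n0); rewrite scaler0 scalerBl -E cE subrr.
Qed.

Lemma tr_linear u c x y : rank_one u -> tr u (c *: x + y) = c * tr u x + tr u y.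
Proof.
move=> uR; have [->|u0] := eqVneq u 0; first by rewrite !tr0 mulr0 addr0.
apply: tr_unique => //.
by rewrite mulrDr mulrDl -scalerAr -scalerAl !trE // scalerA scalerDl.
Qed.

Lemma trD u x y : rank_one u -> tr u (x + y) = tr u x + tr u y.
Proof. by move=> uR; rewrite -{1}[x]scale1r tr_linear // mul1r. Qed.

Lemma tr_eq0 u x : u * x * u = 0 -> tr u x = 0.
Proof.
move=> ux0; have [->|u0] := eqVneq u 0; first exact: tr0.
by apply: tr_unique; rewrite // scale0r.
Qed.

Lemma trB u x y : rank_one u -> tr u (x - y) = tr u x - tr u y.
Proof. by move=> uR; rewrite addrC -scaleN1r tr_linear // mulN1r addrC. Qed.

Lemma trMr u a x : rank_one u -> tr (u * a) x = tr u (a * x).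
Proof.
move=> uR; have [ua0|ua0] := eqVneq (u * a) 0; last first.
  by apply: tr_unique => //; rewrite scalerAl -trE // !mulrA.
have [->|u0] := eqVneq u 0; first by rewrite mul0r !tr0.
by rewrite ua0 tr0; apply/esym/tr_unique; rewrite // mulrA ua0 !mul0r scale0r.
Qed.

(** The matrix determinant lemma. With [w = g^-1 * u] and [t = tr u g^-1] one
    has [w * w = t *: w], so the inverse of [1 + l *: w] is
    [1 - (l / (1 + l * t)) *: w]; if [1 + l * t = 0] then [1 + l *: w] is a
    zero divisor. *)
Lemma unit_rank_one_perturb g u l : rank_one u -> g \is a GRing.unit ->
  (g + l *: u \is a GRing.unit) = (1 + l * tr u g^-1 != 0).
Proof.
move=> uR gU; set t := tr u g^-1; pose w := g^-1 * u.
have -> : g + l *: u = g * (1 + l *: w).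
  by rewrite mulrDr mulr1 -scalerAr /w mulVKr.
rewrite unitrMr //.
have ww : w * w = t *: w by rewrite /w -mulrA [u * _]mulrA trE // -scalerAr.
have wl : (1 + l *: w) * w = (1 + l * t) *: w.
  by rewrite mulrDl mul1r -scalerAl ww scalerA scalerDl scale1r.
have lw : w * (1 + l *: w) = (1 + l * t) *: w.
  by rewrite mulrDr mulr1 -scalerAr ww scalerA scalerDl scale1r.
have [s0|s0] := eqVneq (1 + l * t) 0.
  apply/negbTE/negP => wU; have w0 : w = 0.
    by have := mulKr wU w; rewrite wl s0 scale0r mulr0.
  have u0 : u = 0 by rewrite -(mulVKr gU u) -/w w0 mulr0.
  by move: s0; rewrite /t u0 tr0 mulr0 addr0 => /eqP; rewrite oner_eq0.
apply/unitrP; exists (1 - (l / (1 + l * t)) *: w); split.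
  rewrite mulrBl mul1r -scalerAl lw scalerA divfK //.
  by rewrite addrK.
rewrite mulrBr mulr1 -scalerAr wl scalerA divfK //.
by rewrite addrK.
Qed.

Lemma rank_one_unique_singular_point u : rank_one u -> unique_singular_point u.
Proof.
move=> uR g l m gU; rewrite !unit_rank_one_perturb // !negbK => /eqP l0 /eqP m0.
have t0 : tr u g^-1 != 0.
  by apply/eqP => t0; move: l0; rewrite t0 mulr0 addr0 => /eqP; rewrite oner_eq0.
by apply: (mulIf t0); apply: (addrI 1); rewrite l0 m0.
Qed.

Hypothesis near1 : units_near_one A.
Hypothesis triv : unit_stable_trivial A.

(** Multiplied by a suitable unit, every nonzero element with the property
    [unique_singular_point] becomes a [v] for which [1 - v] is singular. Such a
    [v] turns out to be an idempotent with a division ring as its corner. *)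
Section SingularIdempotent.
Variable v : A.
Hypothesis vP : unique_singular_point v.
Hypothesis vS : 1 - v \isn't a GRing.unit.

(** Being left invertible without being invertible is an open condition, so it
    would make [1 - l *: v] singular for all [l] near [1]. *)
Lemma singular_not_left_invertible z : z * (1 - v) != 1.
Proof.
apply/eqP => z1; have [N /(_ _ (leqnn _))] := near1 (z * v).
set e := N.+1%:R^-1 => eU.
have e0 : e != 0 by rewrite invr_neq0 // natS_neq0.
suff : (1 + (e - 1) *: v \isn't a GRing.unit).
  move=> h; have h1 : 1 + (-1) *: v \isn't a GRing.unit by rewrite scaleN1r.
  move/eqP: (vP (unitr1 _) h h1).
  by rewrite -subr_eq0 opprK subrK (negbTE e0).
apply: contraNN vS => hU.
have zh : z * (1 + (e - 1) *: v) = 1 + e *: (z * v).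
  by rewrite scalerBl scale1r addrCA mulrDr z1 -scalerAr addrC.
have zU : z \is a GRing.unit by rewrite -(unitrMl _ hU) zh.
by rewrite -(unitrMr _ zU) z1 unitr1.
Qed.

(** For a unit [h] congruent to [1] modulo [M], the element [h - v] lies in the
    proper ideal [M], hence is singular, and by uniqueness [h - l *: v] is
    invertible for every other [l]. Starting with [h = 1 + n^-1 *: x] for [x] in
    [M], and using this twice, one writes [1 + x * v] as a product of units.
    Thus [M * v] consists of [unit_stable] elements. *)
Lemma left_ideal_mul_singular (M : set A) y :
  left_ideal M -> ~ M 1 -> M (1 - v) -> M y -> y * v = 0.
Proof.
move=> [[M0 MD] MM] M1 Mv My.
have MZ c x : M x -> M (c *: x) by move=> Mx; rewrite -[_ *: _]addr0; exact: MD.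
have MB x z : M x -> M z -> M (x - z).
  by move=> Mx Mz; rewrite addrC -scaleN1r; exact: MD.
have MA x z : M x -> M z -> M (x + z).
  by move=> Mx Mz; rewrite -[x]scale1r; exact: MD.
have Mh h l : h \is a GRing.unit -> M (h - 1) -> l != 1 ->
    h - l *: v \is a GRing.unit.
  move=> hU Mh1; apply: contra_neqT => hl.
  have hv : h - v \isn't a GRing.unit.
    apply/negP => hvU; apply: M1; rewrite -(mulVr hvU); apply: MM.
    by have := MA _ _ Mh1 Mv; rewrite addrA subrK.
  rewrite -scaleNr in hl; rewrite -scaleN1r in hv.
  exact/oppr_inj/(vP hU hl hv).
have key x : M x -> 1 + x * v \is a GRing.unit.
  move=> Mx; have [N /(_ N.+1 (leqnSn _))] := near1 x.
  set n := N.+2%:R : K; pose h := 1 + n^-1 *: x => hU.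
  have n0 : n != 0 by rewrite natS_neq0.
  have n1 : 1 - n != 0.
    by rewrite /n -natr1 opprD addrCA subrr addr0 oppr_eq0 natS_neq0.
  pose h1 := (1 - n)^-1 *: (1 - n *: v).
  have h1U : h1 \is a GRing.unit.
    rewrite unitZ ?invr_neq0 // Mh ?unitr1 ?subrr //.
    by rewrite eq_sym -subr_eq0.
  have Mh1 : M (h1 - 1).
    have -> : h1 - 1 = (1 - n)^-1 *: (n *: (1 - v)).
      have <- : 1 - n *: v - (1 - n)%:A = n *: (1 - v).
        by rewrite scalerBl scale1r opprB addrC addrA subrK -scalerBr.
      by rewrite [RHS]scalerBr scalerA mulVf // scale1r.
    by apply/MZ/MZ.
  pose h2 := h^-1 * h1.
  have Mh2 : M (h2 - 1).
    have -> : h2 - 1 = h^-1 * ((h1 - 1) - n^-1 *: x).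
      rewrite -addrA -opprD -/h mulrBr mulVr //.
    by apply/MM/MB => //; exact: MZ.
  have l1 : - n / (1 - n) != 1.
    apply/eqP => l1; move/eqP: (divfK n1 (- n)).
    by rewrite l1 mul1r -subr_eq0 opprK subrK oner_eq0.
  (* [1 + x * v = 1 - n *: v + n *: (h * v)], and the first two terms make up
     [(1 - n) *: h1 = (1 - n) *: (h * h2)]. *)
  have -> : 1 + x * v = (1 - n) *: (h * (h2 - (- n / (1 - n)) *: v)).
    have h1E : (1 - n) *: h1 = 1 - n *: v by rewrite scalerA divff ?scale1r.
    rewrite mulrBr /h2 mulVKr // -scalerAr scalerBr h1E scalerA mulrC divfK //.
    rewrite scaleNr opprK /h mulrDl mul1r -scalerAl scalerDr scalerA divff //.
    by rewrite scale1r addrA subrK.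
  by rewrite unitZ // unitrMr // Mh // unitrMr ?unitrV.
apply: triv; apply: unit_stable_of_left_multiples => b.
by rewrite mulrA; apply/key/MM.
Qed.

(** Right multiplication by [v] annihilates the proper left ideal
    [A (1 - v)]. *)
Lemma singular_idempotent : v * v = v.
Proof.
apply/eqP; rewrite eq_sym -subr_eq0 -{1}[v]mul1r -mulrBl; apply/eqP.
apply: (@left_ideal_mul_singular [set b * (1 - v) | b in setT]).
- split; first split; first by exists 0; rewrite ?mul0r.
    move=> c _ _ [a _ <-] [b _ <-]; exists (c *: a + b) => //.
    by rewrite mulrDl -scalerAl.
  by move=> a _ [b _ <-]; exists (a * b); rewrite // mulrA.
- by move=> [b _]; apply/eqP/singular_not_left_invertible.
- by exists 1; rewrite ?mul1r.
- by exists 1; rewrite ?mul1r.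
Qed.

(** Right multiplication by [v] does not annihilate the left ideal
    [A (1 - v) + A v b] when [v * b * v] is nonzero, so this ideal is all of
    [A]; writing [1] as an element of it gives the inverse of [v * b * v]. *)
Lemma singular_division_corner : division_corner v.
Proof.
have vv := singular_idempotent; move=> b vbv.
pose M : set A := [set y | exists a c : A, y = a * (1 - v) + c * (v * b)].
have [[a [c ac1]]|M1] := pselect (M 1).
  exists c.
  have -> : v * c * v * (v * b * v) = v * ((a * (1 - v) + c * (v * b)) * v).
    rewrite mulrDl -!mulrA mulrBl mul1r vv subrr mulr0 add0r.
    by rewrite (mulrA v v) vv.
  by rewrite -ac1 mul1r.
case/eqP: vbv; apply: (@left_ideal_mul_singular M) => //.
- split; first split; first by exists 0, 0; rewrite !mul0r addr0.
    move=> k _ _ [a [c ->]] [a' [c' ->]]; exists (k *: a + a'), (k *: c + c').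
    by rewrite !mulrDl -!scalerAl scalerDr addrACA.
  move=> y _ [a [c ->]]; exists (y * a), (y * c).
  by rewrite mulrDr !mulrA.
- by exists 1, 0; rewrite mul1r mul0r addr0.
- by exists 0, 1; rewrite mul0r mul1r add0r.
Qed.

End SingularIdempotent.

Hypothesis scalar_corners : division_corners_scalar A.

Lemma unique_singular_point_rank_one u : unique_singular_point u -> rank_one u.
Proof.
move=> uP; have [->|u0] := eqVneq u 0.
  by move=> x; exists 0; rewrite mulr0 scaler0.
have [g [gU guN]] : exists g, g \is a GRing.unit /\ g + u \isn't a GRing.unit.
  apply: contrapT => none; case/eqP: u0; apply: triv => g gU.
  by apply: contrapT => /negP guN; apply: none; exists g.
pose v := - (g^-1 * u).
have uE : u = (- g) * v by rewrite /v mulrN mulNr opprK mulVKr.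
have hv h l : h + l *: v = g^-1 * (g * h + (- l) *: u).
  by rewrite mulrDr mulKr // -scalerAr /v scalerN scaleNr.
have vP : unique_singular_point v.
  move=> h l m hU; rewrite !hv !unitrMr ?unitrV // => lN mN.
  by apply/oppr_inj/(uP _ _ _ _ lN mN); rewrite unitrMr.
have vS : 1 - v \isn't a GRing.unit.
  by rewrite -scaleN1r hv mulr1 opprK scale1r unitrMr ?unitrV.
rewrite uE; apply: rank_oneMl; apply: scalar_corners.
- exact: singular_idempotent.
- by apply: contra_neq u0 => v0; rewrite uE v0 mulr0.
- exact: singular_division_corner.
Qed.

End RankOne.

(** * Rank one elements and the socle *)

Section Socle.
Context (K : numFieldType).

Definition trace_separating (A : algType K) :=
  forall a : A, (forall u, rank_one u -> u * a * u = 0) -> a = 0.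

Context (A : unitAlgType K).
Hypothesis triv : unit_stable_trivial A.
Hypothesis scalar_corners : division_corners_scalar A.
Implicit Types (x y a b u v : A) (L : set A).

Lemma semiprime_witness x : x != 0 -> exists c, x * c * x != 0.
Proof.
move=> x0; apply: contrapT => none; case/eqP: x0; apply: (semiprime triv) => b.
by apply/eqP/negPn/negP => xbx; apply: none; exists b.
Qed.

Lemma minimal_left_ideal_rank_one L x :
  minimal_left_ideal L -> L x -> rank_one x.
Proof.
move=> [[[L0 LD] LM] _ Lmin] Lx; have [->|x0] := eqVneq x 0.
  by move=> y; exists 0; rewrite mulr0 scaler0.
have [c xcx] := semiprime_witness x0.
have [k kx|f [ff xf f0 fdiv]] := minimal_left_idempotent xcx; last first.
  by rewrite -xf; apply/rank_oneMl/scalar_corners.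
pose I : set A := [set z * (k * x) | z in setT].
have [I0|IL] : I = [set 0] \/ I = L; last 1 first.
- have : I x by rewrite IL.
  by case=> z _ zE; exists z.
- apply: Lmin; last by move=> _ [z _ <-]; apply/LM/LM.
  split; first split; first by exists 0; rewrite ?mul0r.
    move=> d _ _ [a _ <-] [b _ <-]; exists (d *: a + b) => //.
    by rewrite mulrDl -scalerAl.
  by move=> a _ [b _ <-]; exists (a * b); rewrite // !mulrA.
- case/eqP: kx; have : I (k * x) by exists 1; rewrite ?mul1r.
  by rewrite I0.
Qed.

Lemma minimal_right_ideal_rank_one L x :
  minimal_right_ideal L -> L x -> rank_one x.
Proof.
move=> [[[L0 LD] LM] _ Lmin] Lx; have [->|x0] := eqVneq x 0.
  by move=> y; exists 0; rewrite mulr0 scaler0.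
have [c xcx] := semiprime_witness x0.
have [k xk|f [ff fx f0 fdiv]] := minimal_right_idempotent xcx; last first.
  by rewrite -fx; apply/rank_oneMr/scalar_corners.
pose I : set A := [set x * k * z | z in setT].
have [I0|IL] : I = [set 0] \/ I = L; last 1 first.
- have : I x by rewrite IL.
  by case=> z _ zE; exists z.
- apply: Lmin; last by move=> _ [z _ <-]; apply/LM/LM.
  split; first split; first by exists 0; rewrite ?mulr0.
    move=> d _ _ [a _ <-] [b _ <-]; exists (d *: a + b) => //.
    by rewrite mulrDr -scalerAr.
  by move=> a _ [b _ <-]; exists (b * a); rewrite // mulrA.
- case/eqP: xk; have : I (x * k) by exists 1; rewrite ?mulr1.
  by rewrite I0.
Qed.

(** The common kernel of the functionals [tr u]. *)
Let N : set A := [set a | forall u, rank_one u -> u * a * u = 0].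

Let N_subspace : linear_subspace N.
Proof.
split; first by move=> u _; rewrite mulr0 mul0r.
move=> c x y Nx Ny u uR.
by rewrite mulrDr mulrDl -scalerAr -scalerAl Nx // Ny // scaler0 addr0.
Qed.

(** [u * (a * x) * u] is a multiple of [u] whose scalar is detected by the rank
    one element [u * a]. *)
Let N_left : left_ideal N.
Proof.
split=> // a x Nx u uR; have [c cE] := uR (a * x); rewrite cE.
have [->|c0] := eqVneq c 0; first by rewrite scale0r.
have ua0 : u * a = 0.
  apply: (scalerI c0); rewrite scaler0 scalerAl -cE !mulrA.
  by rewrite -(mulrA _ u a) Nx //; exact: rank_oneMr.
by rewrite -cE mulrA ua0 !mul0r.
Qed.

Let N_right : right_ideal N.
Proof.
split=> // a x Nx u uR; have [c cE] := uR (x * a); rewrite cE.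
have [->|c0] := eqVneq c 0; first by rewrite scale0r.
have au0 : a * u = 0.
  apply: (scalerI c0); rewrite scaler0 scalerAr -cE !mulrA.
  by rewrite -(mulrA _ a u) Nx //; exact: rank_oneMl.
by rewrite -cE -!mulrA au0 !mulr0.
Qed.

Lemma trace_null_annihilated u a : rank_one u -> N a -> u * a = 0.
Proof.
move=> uR Na; apply: (semiprime triv) => b.
have -> : u * a * b * (u * a) = u * (a * b) * u * a by rewrite !mulrA.
by case: N_right => _ /(_ b a Na) -> //; rewrite mul0r.
Qed.

(** The elements [y] with [y * N = 0] form a two-sided ideal that contains all
    rank one elements, hence the socle. So an element [x] of the socle and of
    [N] satisfies [x * b * x = 0] for all [b], and [N] meets the essential socle
    in zero only. *)
Lemma essential_socle_trace_separating :
  essential_ideal (socle A) -> trace_separating A.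
Proof.
move=> [_ socE] a Na; have [N0|N0] := pselect (N = [set 0]).
  by have : N a := Na; rewrite N0.
exfalso; apply: (socE N (conj N_left N_right) N0); apply/seteqP; split; last first.
  move=> _ ->; split; last by case: N_subspace.
  by move=> I [[[[I0 _] _] _] _].
move=> x [socx Nx]; apply: (semiprime triv) => b.
pose I : set A := [set y | forall d, N d -> y * d = 0].
have Isub : linear_subspace I.
  split; first by move=> d _; rewrite mul0r.
  by move=> c y z Iy Iz d Nd; rewrite mulrDl -scalerAl Iy // Iz // scaler0 addr0.
have Ix : I x.
  apply: socx; split; split.
  - by split=> // y z Iz d Nd; rewrite -mulrA Iz // mulr0.
  - split=> // y z Iz d Nd; rewrite -mulrA Iz //.
    by case: N_left => _; exact.
  - move=> L Lmin y Ly d; apply: trace_null_annihilated.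
    exact: minimal_left_ideal_rank_one Ly.
  - move=> L Lmin y Ly d; apply: trace_null_annihilated.
    exact: minimal_right_ideal_rank_one Ly.
by rewrite -mulrA Ix //; case: N_left => _; exact.
Qed.

End Socle.

(** * Separating elements by invertible translates *)

Section Translates.
Context (K : numFieldType) (A : unitAlgType K).
Hypothesis near1 : units_near_one A.
Hypothesis sep : trace_separating A.
Implicit Types (a b c g p q u v : A).

(** [1 + l * s] and [1 + l * t] have the same root [l], provided that it is not
    the root of [1 + l * r]. *)
Lemma eq_reciprocal_root (s t r : K) :
  (forall l, 1 + l * r != 0 -> (1 + l * s != 0) = (1 + l * t != 0)) ->
  [\/ s = t, s = 0 /\ t = r | t = 0 /\ s = r].
Proof.
have root (x y : K) : x != 0 -> 1 + (- x^-1) * y = 0 -> y = x.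
  move=> x0 /eqP; rewrite mulNr subr_eq0 eq_sym => /eqP h.
  by rewrite -[y]mul1r -(mulfV x0) -mulrA h mulr1.
have step (x y : K) :
    (forall l, 1 + l * r != 0 -> (1 + l * x != 0) = (1 + l * y != 0)) ->
    x != y -> x != 0 -> x = r.
  move=> H xy x0; have [h|/H] := eqVneq (1 + (- x^-1) * r) 0.
    by rewrite (root _ _ x0 h).
  rewrite {1}mulNr mulVf // subrr eqxx /= => /esym/negbT; rewrite negbK => /eqP h.
  by rewrite (root _ _ x0 h) eqxx in xy.
move=> H; have [st|st] := eqVneq s t; first by constructor 1.
have sr := step _ _ H st.
have tr : t != 0 -> t = r.
  by apply: (step _ s); rewrite 1?eq_sym // => l /H.
have [s0|s0] := eqVneq s 0.
  by constructor 2; split; rewrite // tr // -s0 eq_sym.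
constructor 3; split; last exact: sr.
by apply/eqP/negPn/negP => t0; rewrite (sr s0) (tr t0) eqxx in st.
Qed.

Lemma tr_separating a b : (forall u, rank_one u -> tr u a = tr u b) -> a = b.
Proof.
move=> ab; apply/eqP; rewrite -subr_eq0; apply/eqP/sep => u uR.
by rewrite mulrBr mulrBl !trE // ab // subrr.
Qed.

(** Comparing the singular [l] of [p + l *: v] and [q + l *: v] leaves one
    exceptional case, where the singular [l] of the first is also singular for
    [c + l *: v] and so escapes the comparison. The comparison for the rank one
    elements [v * w] and [v * (2 *: w + 1)], with [w] chosen such that
    [tr v (w * q^-1) = tr v p^-1], then shows that this trace is zero. *)
Lemma no_exceptional_trace p q c v :
  p \is a GRing.unit -> q \is a GRing.unit -> c \is a GRing.unit ->
  (forall v l, rank_one v -> c + l *: v \is a GRing.unit ->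
    (p + l *: v \is a GRing.unit) = (q + l *: v \is a GRing.unit)) ->
  rank_one v -> tr v q^-1 = 0 -> tr v p^-1 = tr v c^-1 -> tr v p^-1 = 0.
Proof.
move=> pU qU cU H vR q0 pc; apply/eqP/negPn/negP => p0.
have val g : tr v (g * q^-1) != 0 ->
    tr v (g * p^-1) = tr v (g * q^-1) \/ tr v (g * p^-1) = 0.
  move=> gq0; have vgR := rank_oneMr g vR.
  have [l cl|| [] | []] := @eq_reciprocal_root
    (tr v (g * p^-1)) (tr v (g * q^-1)) (tr v (g * c^-1)).
  - rewrite -!trMr // -!unit_rank_one_perturb // H // unit_rank_one_perturb //.
    by rewrite trMr.
  - by left.
  - by right.
  - by move=> E; rewrite E eqxx in gq0.
pose w := c^-1 * q.
have wq : tr v (w * q^-1) = tr v p^-1 by rewrite /w mulrK // pc.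
have lin r : tr v ((2 *: w + 1) * r) = 2 * tr v (w * r) + tr v r.
  by rewrite mulrDl mul1r -scalerAl tr_linear.
have := val (2 *: w + 1); rewrite !lin q0 wq addr0.
rewrite mulf_neq0 ?pnatr_eq0 // => /(_ isT).
have p20 : 2 * tr v p^-1 != 0 by rewrite mulf_neq0 ?pnatr_eq0.
have := val w; rewrite wq => /(_ p0) [->|->]; rewrite ?mulr0 ?add0r => -[/eqP|/eqP].
- by rewrite -subr_eq0 addrAC subrr add0r (negbTE p0).
- by rewrite mulr_natl -mulrSr -mulr_natl mulf_eq0 pnatr_eq0 (negbTE p0).
- by rewrite eq_sym -subr_eq0 mulr_natl mulr2n addrK (negbTE p0).
- by rewrite (negbTE p0).
Qed.

(** For a large scalar [c] the elements [p = c + a] and [q = c + b] are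
    invertible, and the translates by the units [c + l *: v] show
    [tr v p^-1 = tr v q^-1] for all [v] of rank one. *)
Lemma unit_translates_inj a b :
  (forall g, g \is a GRing.unit ->
    a + g \is a GRing.unit <-> b + g \is a GRing.unit) ->
  a = b.
Proof.
move=> ab; have [N NP] := unit_natS_add near1 a.
have [M MP] := unit_natS_add near1 b.
have := NP _ (leq_addr M N); have := MP _ (leq_addl N M).
set c : A := (N + M).+1%:R%:A => qU pU.
have cU : c \is a GRing.unit by rewrite unitZ ?unitr1 // natS_neq0.
have H v l : rank_one v -> c + l *: v \is a GRing.unit ->
    (c + a + l *: v \is a GRing.unit) = (c + b + l *: v \is a GRing.unit).
  move=> _ /ab; rewrite ![_ + (c + _)]addrCA !addrA => e.
  by apply/idP/idP => /e.
apply: (addrI c); apply: invr_inj; apply: tr_separating => v vR.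
have [l cl||[p0 qc]|[q0 pc]] := @eq_reciprocal_root
  (tr v (c + a)^-1) (tr v (c + b)^-1) (tr v c^-1).
- by rewrite -!unit_rank_one_perturb // H // unit_rank_one_perturb.
- by [].
- rewrite p0; apply/esym; apply: (no_exceptional_trace qU pU cU) => // u l uR cl.
  by rewrite H.
- by rewrite q0; apply: (no_exceptional_trace pU qU cU).
Qed.

End Translates.

(** * Linearization through traces *)

Section Transfer.
Context (K : numFieldType) (A B : unitAlgType K).
Hypothesis nearA : units_near_one A.
Hypothesis sepA : trace_separating A.
Hypothesis nearB : units_near_one B.
Hypothesis trivB : unit_stable_trivial B.
Hypothesis scalarB : division_corners_scalar B.

Definition linear_unit_bijection (L : {linear A -> B}) :=
  bijective L /\ forall a, (L a \is a GRing.unit) = (a \is a GRing.unit).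

(** A map [F] defined on units and paired with a map [kappa] on rank one
    elements. The hypothesis [kappaF] amounts to [tr (kappa u) (F g) = tr u g]
    for all units [g], where the right-hand side is linear in [g]. *)
Section Duality.
Variables kappa F : A -> B.
Hypothesis F_unit : forall g, g \is a GRing.unit -> F g \is a GRing.unit.
Hypothesis F_onto : forall b, b \is a GRing.unit ->
  exists2 g, g \is a GRing.unit & F g = b.
Hypothesis kappaF : forall u g l, rank_one u -> g \is a GRing.unit ->
  l *: kappa u + (F g)^-1 \is a GRing.unit <-> l *: u + g^-1 \is a GRing.unit.

Lemma kappa_rank_one u : rank_one u -> rank_one (kappa u).
Proof.
move=> uR; apply: unique_singular_point_rank_one => // h l m hU.
have [g gU gE] : exists2 g, g \is a GRing.unit & F g = h^-1.
  by apply: F_onto; rewrite unitrV.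
have perturb k : (h + k *: kappa u \is a GRing.unit) =
    (g^-1 + k *: u \is a GRing.unit).
  by rewrite -[h]invrK -gE addrC [in RHS]addrC; apply/idP/idP => /kappaF; apply.
rewrite !perturb; apply: rank_one_unique_singular_point => //.
by rewrite unitrV.
Qed.

Lemma tr_kappa u g :
  rank_one u -> g \is a GRing.unit -> tr (kappa u) (F g) = tr u g.
Proof.
move=> uR gU; have kR := kappa_rank_one uR.
have gVU : g^-1 \is a GRing.unit by rewrite unitrV.
have FVU : (F g)^-1 \is a GRing.unit by rewrite unitrV F_unit.
have Fl l : (1 + l * tr (kappa u) (F g) != 0) =
    (l *: kappa u + (F g)^-1 \is a GRing.unit).
  by rewrite [in RHS]addrC unit_rank_one_perturb // invrK.
have gl l : (1 + l * tr u g != 0) = (l *: u + g^-1 \is a GRing.unit).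
  by rewrite [in RHS]addrC unit_rank_one_perturb // invrK.
have [l _|//|[-> ->]//|[-> ->]//] :=
  @eq_reciprocal_root _ (tr (kappa u) (F g)) (tr u g) 0.
by rewrite Fl gl; apply/idP/idP => /kappaF; apply.
Qed.

(** For a large scalar [c], both [c + (b - b')] and [c] are values of [F], and
    the traces of their preimages in [A] agree. Hence the functionals
    [tr (kappa u)] separate the points of [B] as soon as the [tr u] separate
    those of [A]. *)
Lemma kappa_separating b b' :
  (forall u, rank_one u -> tr (kappa u) b = tr (kappa u) b') -> b = b'.
Proof.
move=> bb'; have [N /(_ _ (leqnn _))] := unit_natS_add nearB (b - b').
set c : B := N.+1%:R%:A => cbU.
have cU : c \is a GRing.unit by rewrite unitZ ?unitr1 // natS_neq0.
have [g gU gE] := F_onto cbU; have [h hU hE] := F_onto cU.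
have gh : g = h.
  apply: (tr_separating sepA) => u uR; have kR := kappa_rank_one uR.
  by rewrite -!tr_kappa // gE hE trD // trB // bb' // subrr addr0.
by move: gE; rewrite gh hE -[LHS]addr0 => /addrI/esym/eqP; rewrite subr_eq0 => /eqP.
Qed.

Lemma duality_separating : trace_separating B.
Proof.
move=> b b0; apply: kappa_separating => u uR; have kR := kappa_rank_one uR.
by rewrite !tr_eq0 ?b0 // mulr0 mul0r.
Qed.

(** The image of [a] is the [b] with [tr (kappa u) b = tr u a] for all [u] of
    rank one; such a [b] exists because [a] is a sum of two units. *)
Lemma duality_linear : exists L : {linear A -> B},
  linear_unit_bijection L /\ forall g, g \is a GRing.unit -> L g = F g.
Proof.
have ex a : exists b, forall u, rank_one u -> tr (kappa u) b = tr u a.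
  have [g [h [gU hU ->]]] := sum_of_units nearA a.
  exists (F g + F h) => u uR.
  by rewrite !trD ?tr_kappa //; exact: kappa_rank_one.
have [f fP] := choice ex.
have flin : linear f.
  move=> c x y; apply: kappa_separating => u uR.
  by rewrite fP // !tr_linear ?fP //; exact: kappa_rank_one.
have fF g : g \is a GRing.unit -> f g = F g.
  by move=> gU; apply: kappa_separating => u uR; rewrite fP // tr_kappa.
pose L : {linear A -> B} := HB.pack f (GRing.isLinear.Build K A B _ f flin).
exists L; split; last exact: fF.
have finj : injective f.
  by move=> x y xy; apply: (tr_separating sepA) => u uR; rewrite -!fP // xy.
split; last first.
  move=> a; apply/idP/idP => [LU|aU]; last by rewrite /= fF // F_unit.
  have [g gU gE] := F_onto LU.
  by have -> : a = g by apply: finj; rewrite (fF g gU) gE.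
have fsurj b : exists a, f a == b.
  have [g [h [gU hU ->]]] := sum_of_units nearB b.
  have [g' g'U <-] := F_onto gU; have [h' h'U <-] := F_onto hU.
  exists (g' + h'); rewrite -!fF //; apply/eqP; exact: (raddfD L).
have [f' f'P] := choice fsurj.
by exists f' => [x|b]; [apply: finj; exact/eqP|exact/eqP].
Qed.

End Duality.

Lemma inv_add_inv_1sub (T : unitRingType) (a : T) :
  a \is a GRing.unit -> 1 - a \is a GRing.unit ->
  a^-1 + (1 - a)^-1 = (a - a ^+ 2)^-1.
Proof.
move=> aU bU; have aE : a - a ^+ 2 = a * (1 - a) by rewrite mulrBr mulr1.
have aE' : a * (1 - a) = (1 - a) * a by rewrite mulrBr mulrBl mulr1 mul1r.
have abU : a * (1 - a) \is a GRing.unit by rewrite unitrMr.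
rewrite aE; apply: (mulrI abU); rewrite divrr // mulrDr mulrK //.
by rewrite aE' mulrK // subrK.
Qed.

Lemma sqr_scalar_add (T : algType K) (c : K) (x : T) :
  (c%:A + x) ^+ 2 = (c ^+ 2)%:A + (2 * c) *: x + x ^+ 2.
Proof.
rewrite expr2 mulrDl !mulrDr !mulr_algl mulr_algr scalerA addrA.
by rewrite -(addrA _ (c *: x) (c *: x)) -scalerDl !expr2 [2 * c]mulr_natl mulr2n.
Qed.

(** Applying [J] to both sides of [inv_add_inv_1sub] gives
    [T (a ^+ 2) = T a ^+ 2] for [T = (P 1)^-1 * P], when [a] and [1 - a] are
    units. The general case follows by adding a scalar [c] to [x] such that
    [c + x] and [c - 1 + x] are units. *)
Lemma inverse_linear_jordan (P J : {linear A -> B}) :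
  (forall g, g \is a GRing.unit -> P g \is a GRing.unit) ->
  (forall g, g \is a GRing.unit -> J g^-1 = (P g)^-1) ->
  forall x, (P 1)^-1 * P (x ^+ 2) = ((P 1)^-1 * P x) ^+ 2.
Proof.
move=> PU JP; set e := P 1.
have eU : e \is a GRing.unit by exact: PU (unitr1 _).
pose T x := e^-1 * P x; have PT x : P x = e * T x by rewrite /T mulVKr.
have T1 : T 1 = 1 by rewrite /T mulVr.
have TD x y : T (x + y) = T x + T y by rewrite /T raddfD mulrDr.
have TN x : T (- x) = - T x by rewrite /T raddfN mulrN.
have TZ c x : T (c *: x) = c *: T x by rewrite /T linearZ /= scalerAr.
have TU g : g \is a GRing.unit -> T g \is a GRing.unit.
  by move=> gU; rewrite unitrMr ?unitrV // PU.
suff main x : T (x ^+ 2) = T x ^+ 2 by exact: main.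
clearbody T.
have Tsqr a : a \is a GRing.unit -> 1 - a \is a GRing.unit ->
    T (a ^+ 2) = T a ^+ 2.
  move=> aU bU; have TbU : 1 - T a \is a GRing.unit by rewrite -T1 -TN -TD TU.
  have abU : a - a ^+ 2 \is a GRing.unit.
    by rewrite expr2 -{1}[a]mulr1 -mulrBr unitrMr.
  have TaU := TU _ aU.
  have TabU : T a - T a ^+ 2 \is a GRing.unit.
    by rewrite expr2 -{1}[T a]mulr1 -mulrBr unitrMr.
  have : J a^-1 + J (1 - a)^-1 = J (a - a ^+ 2)^-1.
    by rewrite -inv_add_inv_1sub // raddfD.
  have := TU _ abU; rewrite TD TN => TabU'.
  rewrite !JP // !PT !TD !TN T1 !invrM // -mulrDl inv_add_inv_1sub //.
  have eVU : e^-1 \is a GRing.unit by rewrite unitrV.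
  by move=> /(mulIr eVU)/(can_inj (@invrK B))/addrI/oppr_inj ->.
have [N NU] := unit_natS_add nearA x.
pose c := N.+2%:R : K.
have := Tsqr (c%:A + x) (NU _ (leqnSn _)).
have -> : 1 - (c%:A + x) = - (N.+1%:R%:A + x).
  by rewrite /c -[N.+2%:R]natr1 scalerDl scale1r addrAC opprD addrCA subrr addr0.
rewrite unitrN NU // => /(_ isT).
by rewrite sqr_scalar_add !TD !TZ T1 sqr_scalar_add => /addrI.
Qed.

End Transfer.

(** * Pairs of maps that preserve invertibility *)

Section Preservers.
Context (K : numFieldType) (A B : unitAlgType K).
Variables phi psi : A -> B.
Hypothesis phi_onto : forall b, exists a, phi a = b.
Hypothesis psi_onto : forall b, exists a, psi a = b.
Hypothesis phi_psi_unit : forall x y (l : K),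
  l *: x + y \is a GRing.unit <-> l *: phi x + psi y \is a GRing.unit.

Lemma psi_unit y : (psi y \is a GRing.unit) = (y \is a GRing.unit).
Proof.
have := phi_psi_unit 0 y 0; rewrite !scale0r !add0r => h.
by apply/idP/idP => /h.
Qed.

Lemma psi_unit_onto b : b \is a GRing.unit ->
  exists2 y, y \is a GRing.unit & psi y = b.
Proof.
by move=> bU; have [y yE] := psi_onto b; exists y; rewrite // -psi_unit yE.
Qed.

Lemma phi_psi_add_unit x y :
  (phi x + psi y \is a GRing.unit) = (x + y \is a GRing.unit).
Proof.
have := phi_psi_unit x y 1; rewrite !scale1r => h.
by apply/idP/idP => /h.
Qed.

Hypothesis trivA : unit_stable_trivial A.

(** If [phi x] is [unit_stable], so is [x]: the property speaks only of the
    sums [phi x + psi g] with [g] a unit. *)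
Lemma psi_range_unit_stable_trivial : unit_stable_trivial B.
Proof.
have phi0 x : unit_stable (phi x) -> x = 0.
  move=> xU; apply: trivA => g gU.
  by rewrite addrC -phi_psi_add_unit addrC; apply: xU; rewrite psi_unit.
have [z z0] := phi_onto 0.
move=> d; have [x <-] := phi_onto d => /phi0 ->.
suff /phi0 <- : unit_stable (phi z) by [].
by rewrite z0 => g gU; rewrite addr0.
Qed.

Hypothesis nearA : units_near_one A.
Hypothesis sepA : trace_separating A.
Hypothesis nearB : units_near_one B.
Hypothesis scalarB : division_corners_scalar B.

Theorem invertibility_preserving_pair : exists u : B, u \is a GRing.unit /\
  exists J : {linear A -> B}, jordan_isomorphism J /\
    forall x : A, phi x = psi x /\ psi x = u * J x.
Proof.
have trivB := psi_range_unit_stable_trivial.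
pose F g := (psi g^-1)^-1.
have FV g : F g^-1 = (psi g)^-1 by rewrite /F invrK.
have FU g : g \is a GRing.unit -> F g \is a GRing.unit.
  by move=> gU; rewrite unitrV psi_unit unitrV.
have F_onto b : b \is a GRing.unit -> exists2 g, g \is a GRing.unit & F g = b.
  move=> bU; have bVU : b^-1 \is a GRing.unit by rewrite unitrV.
  have [y yU yE] := psi_unit_onto bVU.
  by exists y^-1; rewrite ?unitrV // /F invrK yE invrK.
have phiF u g l : rank_one u -> g \is a GRing.unit ->
    l *: phi u + (F g)^-1 \is a GRing.unit <-> l *: u + g^-1 \is a GRing.unit.
  by move=> _ _; rewrite invrK; apply: iff_sym.
(* [phi] is dual to [F], and [F] extends to the linear map [J]. *)
have sepB := duality_separating sepA nearB trivB scalarB FU F_onto phiF.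
have [J [[_ JU] JF]] :=
  duality_linear nearA sepA nearB trivB scalarB FU F_onto phiF.
(* [J] is dual to [psi], and [psi] on units extends to the linear map [P]. *)
have Jpsi u g l : rank_one u -> g \is a GRing.unit ->
    l *: J u + (psi g)^-1 \is a GRing.unit <-> l *: u + g^-1 \is a GRing.unit.
  by move=> _ gU; rewrite -JU linearD linearZ /= (JF g^-1) ?unitrV // FV.
have psiU g : g \is a GRing.unit -> psi g \is a GRing.unit by rewrite psi_unit.
have [P [[Pbij PU] Ppsi]] :=
  duality_linear nearA sepA nearB trivB scalarB psiU psi_unit_onto Jpsi.
have phiP x : phi x = P x.
  apply: (unit_translates_inj nearB sepB) => b bU.
  have [g gU gE] := psi_unit_onto bU.
  by rewrite -{1}gE phi_psi_add_unit -gE -Ppsi // -raddfD PU.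
have psiP x : psi x = P x.
  apply: (unit_translates_inj nearB sepB) => b bU.
  have [g gU gE] := psi_unit_onto bU.
  have bE : b = P g by rewrite -gE Ppsi.
  by rewrite addrC {1}bE -phiP phi_psi_add_unit bE addrC -raddfD PU.
have eU : P 1 \is a GRing.unit by rewrite PU unitr1.
exists (P 1); split => //.
pose T x := (P 1)^-1 * P x.
have Tlin : linear T by move=> c x y; rewrite /T linearP mulrDr scalerAr.
pose L : {linear A -> B} := HB.pack T (GRing.isLinear.Build K A B _ T Tlin).
exists L; split; last by move=> x; rewrite phiP psiP /L /= /T mulVKr.
split.
  have [P' PK P'K] := Pbij; exists (fun b => P' (P 1 * b)) => [x|b].
    by rewrite /L /= /T mulVKr.
  by rewrite /L /= /T P'K mulKr.
apply: (inverse_linear_jordan nearA (J := J)) => g gU; first by rewrite PU.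
by rewrite JF ?unitrV // FV Ppsi.
Qed.

End Preservers.

(** * The case of Banach algebras *)

Section BanachInstances.
Context (R : realType) (A : unitalBanachAlgType (cplx R)).

Lemma banach_units_near_one : units_near_one A.
Proof.
move=> x; have [d [d0 dP]] := unit_near1 x; exists (Num.bound d^-1) => n Nn.
apply: dP; rewrite rnormcV -[leRHS]invrK lef_pV2 ?posrE ?invr_gt0 //.
  rewrite [rnorm _](_ : _ = n.+1%:R); last by rewrite /rnorm normr_nat raddfMn.
  apply: ltW; apply: lt_le_trans (archi_boundP _) _; first by rewrite ltW ?invr_gt0.
  by rewrite ler_nat leqW.
by rewrite lt_neqAle eq_sym rnorm_eq0 pnatr_eq0 rnorm_ge0.
Qed.

(** If [f * x * f] is no scalar multiple of [f], then [w *: f - f * x * f] is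
    invertible in the division ring [f A f] for every [w]. *)
Lemma banach_division_corners_scalar : division_corners_scalar A.
Proof.
move=> f ff f0 fdiv x; apply: contrapT => none.
pose y := f * x * f.
have fy : f * y = y by rewrite /y !mulrA ff.
have yf : y * f = y by rewrite /y -!mulrA ff.
have corner w : f * (w%:A - x) * f = w *: f - y.
  by rewrite mulrBr mulrBl mulr_algr -scalerAl ff.
have left w : exists z, f * z * f * (w *: f - y) = f.
  have := fdiv (w%:A - x); rewrite corner; apply.
  by rewrite subr_eq0; apply/eqP => wy; apply: none; exists w.
have [z zP] := choice left; pose r w := f * z w * f.
have fr w : f * r w = r w by rewrite /r !mulrA ff.
have rf w : r w * f = r w by rewrite /r -!mulrA ff.
apply: (@no_global_resolvent R A f y r f0 yf rf fr) => // w.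
have [s sE] : exists s, f * s * f * r w = f.
  by apply: fdiv; apply: contra_neq f0 => r0; rewrite -(zP w) -/(r w) /r r0 mul0r.
suff -> : w *: f - y = f * s * f by [].
have fa : f * (w *: f - y) = w *: f - y by rewrite mulrBr -scalerAr ff fy.
by rewrite -{1}fa -{1}sE -[in LHS]mulrA zP -!mulrA ff.
Qed.

End BanachInstances.

Theorem theorem3p1 (R : realType) (A B : unitalBanachAlgType R[i])
    (phi psi : A -> B)
    (phi_surj : set_surj [set: A] [set: B] phi)
    (psi_surj : set_surj [set: A] [set: B] psi)
    (semisimpleA : semisimple A)
    (essentialA : essential_ideal (socle A))
    (phi_psi_unit : forall (x y : A) (lambda : R[i]),
       lambda *: x + y \is a GRing.unit <->
       lambda *: phi x + psi y \is a GRing.unit) :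
  exists u : B, u \is a GRing.unit /\
    exists J : {linear A -> B}, jordan_isomorphism J /\
      forall x : A, phi x = psi x /\ psi x = u * J x.
Proof.
have nearA := @banach_units_near_one R A.
have trivA := semisimple_unit_stable_trivial nearA semisimpleA.
have scalarA := @banach_division_corners_scalar R A.
apply: (@invertibility_preserving_pair _ A B phi psi) => //.
- by move=> b; have [a _ <-] := phi_surj b I; exists a.
- by move=> b; have [a _ <-] := psi_surj b I; exists a.
- exact: essential_socle_trace_separating.
- exact: (@banach_units_near_one R B).
- exact: (@banach_division_corners_scalar R B).
Qed.
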